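(* Let $F(X_0,X_1;Y_0,Y_1)\in\mathbb{F}_q[X_0,X_1,Y_0,Y_1]$ be an irreducible bi-homogeneous polynomial of bi-degree $(a,b)$, and let $C$ be the curve on $\mathbb{P}^1\times\mathbb{P}^1$ defined by $F=0$. Suppose that $C(\mathbb{F}_q)=\mathbb{P}^1(\mathbb{F}_q)\times\mathbb{P}^1(\mathbb{F}_q)$. Then $a\geq q+1$ and $b\geq q+1$. More precisely, there are bi-homogeneous polynomials $f$ and $g$ in $\mathbb{F}_q[X_0,X_1,Y_0,Y_1]$ of bi-degree $(a-(q+1),b)$ and $(a,b-(q+1))$ respectively such that \[ F=f\cdot(X_0^qX_1-X_0X_1^q)+g\cdot(Y_0^qY_1-Y_0Y_1^q). \]
   Context: $\mathbb{F}_q$ is the finite field with $q$ elements. A polynomial in $X_0,X_1,Y_0,Y_1$ is bi-homogeneous of bi-degree $(a,b)$ if it is homogeneous of degree $a$ in $X_0,X_1$ and homogeneous of degree $b$ in $Y_0,Y_1$; the zero polynomial is regarded as bi-homogeneous of every bi-degree. $X_0,X_1$ are homogeneous coordinates on the first factor of $\mathbb{P}^1\times\mathbb{P}^1$, and $Y_0,Y_1$ on the second. $C(\mathbb{F}_q)$ denotes the set of $\mathbb{F}_q$-points of $C$, i.e. the points of $\mathbb{P}^1(\mathbb{F}_q)\times\mathbb{P}^1(\mathbb{F}_q)$ at which $F$ vanishes. *)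

(* Defs.v *)
From HB Require Import structures.
From mathcomp Require Import all_boot all_order all_algebra.
From mathcomp Require Export mpoly.

Set Implicit Arguments.
Unset Strict Implicit.
Unset Printing Implicit Defensive.

Import GRing.Theory.
Local Open Scope ring_scope.

Definition irreducible_elt (R : idomainType) (p : R) : Prop :=
  [/\ p != 0, p \isn't a GRing.unit &
      forall u v : R, p = u * v -> u \is a GRing.unit \/ v \is a GRing.unit].

(* The four variables are indexed by 'I_(2 + 2): the left summand indexes
   X_0, X_1 and the right summand Y_0, Y_1. *)
Section Variables.
Variable K : fieldType.

Definition X0 : {mpoly K[2 + 2]} := 'X_(lshift 2 ord0).
Definition X1 : {mpoly K[2 + 2]} := 'X_(lshift 2 ord_max).
Definition Y0 : {mpoly K[2 + 2]} := 'X_(rshift 2 ord0).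
Definition Y1 : {mpoly K[2 + 2]} := 'X_(rshift 2 ord_max).

End Variables.

Arguments X0 {K}.
Arguments X1 {K}.
Arguments Y0 {K}.
Arguments Y1 {K}.

Definition degX (m : 'X_{1..2 + 2}) : nat := \sum_(i < 2) m (lshift 2 i).
Definition degY (m : 'X_{1..2 + 2}) : nat := \sum_(i < 2) m (rshift 2 i).

Lemma degX0 : degX 0%MM = 0%N.
Proof. by rewrite /degX big1 // => i _; rewrite mnm0E. Qed.

Lemma degXD : {morph degX : m1 m2 / (m1 + m2)%MM >-> (m1 + m2)%N}.
Proof.
by move=> m1 m2; rewrite /degX -big_split /=; apply: eq_bigr => i _; rewrite mnmDE.
Qed.

Lemma degY0 : degY 0%MM = 0%N.
Proof. by rewrite /degY big1 // => i _; rewrite mnm0E. Qed.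

Lemma degYD : {morph degY : m1 m2 / (m1 + m2)%MM >-> (m1 + m2)%N}.
Proof.
by move=> m1 m2; rewrite /degY -big_split /=; apply: eq_bigr => i _; rewrite mnmDE.
Qed.

HB.instance Definition _ := isMeasure.Build (2 + 2) degX degX0 degXD.
HB.instance Definition _ := isMeasure.Build (2 + 2) degY degY0 degYD.

Definition bihomog (K : fieldType) (a b : nat) (p : {mpoly K[2 + 2]}) : bool :=
  (p \is ishomog1 a degX) && (p \is ishomog1 b degY).

(* Points are the one-dimensional subspaces of K^2. *)
Definition proj_line (K : fieldType) : predArgType :=
  {L : {vspace 'rV[K]_2} | \dim L == 1%N}.

(* The K-points of the curve F = 0, for bi-homogeneous F: vanishing at (P, Q)
   means vanishing at all homogeneous coordinates x of P and y of Q. *)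
Definition curve_points (K : finFieldType) (F : {mpoly K[2 + 2]}) :
    {pred proj_line K * proj_line K} :=
  fun PQ => [forall x : 'rV[K]_2, forall y : 'rV[K]_2,
    [&& x \in val PQ.1, x != 0, y \in val PQ.2 & y != 0] ==>
    (F.@[row_mx x y ord0] == 0)].

(* Main.v *)
Require Import Defs.
From mathcomp Require Import all_boot all_order all_algebra.
From mathcomp Require Import finfield zify ring.

Set Implicit Arguments.
Unset Strict Implicit.
Unset Printing Implicit Defensive.

Import GRing.Theory.
Local Open Scope ring_scope.

(** Write U = X0^q X1 - X0 X1^q and V = Y0^q Y1 - Y0 Y1^q.  Modulo U, a form of
    degree n in X0, X1 can be rewritten, without changing its degree or its
    values at rational points, as a combination of X0^n and of the X0^i X1^(n-i)
    with i < q ([monomial_reduction]).  Such a reduced form is determined by its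
    values on the projective line over the field with q elements: its value at
    (1 : 0) is the coefficient of X0^n, and what remains is, at X1 = 1, a
    polynomial of degree less than q, determined by its q values
    ([reduced_form_eq0]).

    Reducing the monomials of F in both pairs of variables gives F = R + f U + g V
    with f and g explicit ([bimonomial_reduction]).  The form F vanishes at all
    pairs of points.  Freezing the point of the second line, the uniqueness above
    applies to the reduction in X; each coefficient obtained is a form in Y that
    vanishes on the whole second line, so the uniqueness applies again, and all
    coefficients of R are zero.

    The degree bounds come from the same computation: if a < q + 1, every monomial
    in X0, X1 is already reduced, so f = 0 and F = g V.  This contradicts
    irreducibility, because Y0 divides V and the cofactor is not a unit
    ([frob_form_multiple_reducible]).  The bound on b is symmetric. *)

(** * Reduction of binary forms *)

Definition frob_form (R : comNzRingType) (q : nat) (s t : R) : R :=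
  s ^+ q * t - s * t ^+ q.

(** Modulo s^q t - s t^q, the exponent of s may be lowered by q - 1 whenever both
    exponents stay positive: positive exponents below n are brought into
    [1, q - 1], while the exponents 0 and n, where one of the variables is absent,
    are kept. *)
Definition reduced_exp (q n i : nat) : nat :=
  if i == n then n else if i is j.+1 then (j %% q.-1).+1 else 0%N.

(** The quotient of s^i t^(n-i) - s^r t^(n-r), where r is the reduced exponent, by
    s t (s^(q-1) - t^(q-1)): the sum is the cofactor of x - y in the difference of
    powers x^k - y^k at x = s^(q-1) and y = t^(q-1), where i = r + k (q - 1). *)
Definition reduction_quotient (R : comNzRingType) (q n i : nat) (s t : R) : R :=
  if i == n then 0 else
  s ^+ (i.-1 %% q.-1) * t ^+ (n - i).-1 *
  \sum_(l < i.-1 %/ q.-1)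
     (s ^+ q.-1) ^+ ((i.-1 %/ q.-1).-1 - l) * (t ^+ q.-1) ^+ l.

Lemma reduced_exp_le q n i : (i <= n)%N -> (reduced_exp q n i <= i)%N.
Proof.
rewrite /reduced_exp; case: eqP => [->|_] //.
by case: i => // j _; rewrite ltnS leq_mod.
Qed.

Lemma reduced_exp_small q n i : (1 < q)%N ->
  (reduced_exp q n i == n) || (reduced_exp q n i < q)%N.
Proof.
move=> q_gt1; rewrite /reduced_exp; case: (i =P n) => [_|_]; first by rewrite eqxx.
apply/orP; right; case: i => [|j]; first exact: ltnW.
by rewrite -[X in (_ < X)%N](ltn_predK q_gt1) ltnS ltn_mod -ltnS (ltn_predK q_gt1).
Qed.

(** This identity is used in two rings: among polynomials, and in the field with q
    elements, where [frob_form q s t] is zero, so that reduction keeps values. *)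
Lemma monomial_reduction (R : comNzRingType) q n i (s t : R) :
    (1 < q)%N -> (i <= n)%N ->
  s ^+ i * t ^+ (n - i) =
    s ^+ reduced_exp q n i * t ^+ (n - reduced_exp q n i)
    + frob_form q s t * reduction_quotient q n i s t.
Proof.
move=> q_gt1 le_in; rewrite /reduced_exp /reduction_quotient.
case: eqP => [->|/eqP ne_in]; first by rewrite mulr0 addr0.
have {le_in ne_in} lt_in: (i < n)%N by rewrite ltn_neqAle ne_in.
case: i lt_in => [|j] lt_jn.
  by rewrite /= div0n big_ord0 !mulr0 addr0.
rewrite /= /frob_form; set d := q.-1; have q_eq : q = d.+1 by rewrite (ltn_predK q_gt1).
rewrite q_eq; clearbody d; clear q_eq.
have ej := divn_eq j d; move: ej; set r := (j %% d)%N; set T := (j %/ d)%N => ej.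
have -> : s ^+ d.+1 * t - s * t ^+ d.+1 = s * t * (s ^+ d - t ^+ d).
  by rewrite !exprS; ring.
have -> : s * t * (s ^+ d - t ^+ d) * (s ^+ r * t ^+ (n - j.+1).-1 *
     \sum_(l < T) (s ^+ d) ^+ (T.-1 - l) * (t ^+ d) ^+ l)
  = s * t * s ^+ r * t ^+ (n - j.+1).-1 * ((s ^+ d) ^+ T - (t ^+ d) ^+ T).
  by rewrite (subrXX (s ^+ d) (t ^+ d) T); ring.
have [w ->] : exists w, n = (w + j.+2)%N by exists (n - j.+2)%N; rewrite subnK.
have -> : (w + j.+2 - j.+1 = w.+1)%N by lia.
have -> : (w + j.+2 - r.+1 = w.+1 + T * d)%N by lia.
rewrite [in s ^+ j.+1]ej -!exprM [(d * T)%N]mulnC exprD !exprS exprD /=.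
by ring.
Qed.

Lemma bimonomial_reduction (R : comNzRingType) q a b i j (s t u v : R) :
    (1 < q)%N -> (i <= a)%N -> (j <= b)%N ->
  s ^+ i * t ^+ (a - i) * (u ^+ j * v ^+ (b - j)) =
    s ^+ reduced_exp q a i * t ^+ (a - reduced_exp q a i)
      * (u ^+ reduced_exp q b j * v ^+ (b - reduced_exp q b j))
    + (reduction_quotient q a i s t * (u ^+ j * v ^+ (b - j)) * frob_form q s t
       + s ^+ reduced_exp q a i * t ^+ (a - reduced_exp q a i)
           * reduction_quotient q b j u v * frob_form q u v).
Proof.
move=> q_gt1 le_ia le_jb; rewrite (monomial_reduction s t q_gt1 le_ia).
rewrite mulrDl {1}(monomial_reduction u v q_gt1 le_jb).
by ring.
Qed.

(** Below degree q + 1 there is no multiple of the form of degree q + 1 to subtract. *)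
Lemma reduction_quotient_eq0 (R : comNzRingType) q n i (s t : R) :
  (1 < q)%N -> (i <= n)%N -> (n < q + 1)%N -> reduction_quotient q n i s t = 0.
Proof.
move=> q_gt1 le_in lt_nq; rewrite /reduction_quotient; case: eqP => // /eqP ne_in.
case: (ltnP i.-1 q.-1) => [lt_iq|]; last by lia.
by rewrite divn_small // big_ord0 mulr0.
Qed.

(** The weight e of the variables is arbitrary so that, with e = 1 and e = 0, the
    same lemma gives the degree in either pair of variables. *)
Lemma reduction_quotient_homog (K : fieldType) N (mf : measure N) q n i e
    (s t : {mpoly K[N]}) :
    (1 < q)%N -> (i <= n)%N -> s \is e.-homog for mf -> t \is e.-homog for mf ->
  reduction_quotient q n i s t \is (e * (n - (q + 1))).-homog for mf.
Proof.
move=> q_gt1 le_in hs ht; rewrite /reduction_quotient.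
case: eqP => [_|/eqP ne_in]; first exact: rpred0.
rewrite mulr_sumr; apply: rpred_sum => -[l lt_l] _ /=.
have ei := divn_eq i.-1 q.-1; move: lt_l ei.
set r := (i.-1 %% q.-1)%N; set T := (i.-1 %/ q.-1)%N => lt_l ei.
suff -> : (e * (n - (q + 1)) = (e * r + e * (n - i).-1)
             + (e * q.-1 * (T.-1 - l) + e * q.-1 * l))%N.
  by apply: dhomogM; apply: dhomogM; do ?apply: dhomogMn.
rewrite -!mulnA -!mulnDr; congr (_ * _)%N.
rewrite subnK; last by lia.
case: T lt_l ei => // T _; rewrite mulSn /= => ei.
rewrite mulnC; lia.
Qed.

(** * Forms vanishing at all rational points *)

(** The value at (1, 0) isolates the exponent n; the other terms then form, at
    t = 1, a polynomial of size at most #|K| having every element of K as a root.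
    The form is a family of terms with possibly repeated exponents, so that
    it can be indexed by the monomials of a polynomial in more variables. *)
Lemma reduced_form_eq0 (K : finFieldType) (I : Type) (r : seq I) (P : pred I)
    (c : I -> K) (e : I -> nat) n :
    (forall i, P i -> (e i <= n)%N) ->
    (forall i, P i -> (e i == n) || (e i < #|K|)%N) ->
    (forall s t : K, (s != 0) || (t != 0) ->
       \sum_(i <- r | P i) c i * (s ^+ e i * t ^+ (n - e i)) = 0) ->
  forall k, \sum_(i <- r | P i && (e i == k)) c i = 0.
Proof.
move=> le_en e_red vanish.
(* At (1, 0) every term with exponent below n carries a positive power of 0. *)
have top0 : \sum_(i <- r | P i && (e i == n)) c i = 0.
  rewrite -[RHS](vanish 1 0) ?oner_eq0 // [RHS](bigID (fun i => e i == n)) /=.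
  rewrite [X in _ = _ + X]big1 => [|i /andP[Pi ne_in]]; last first.
    rewrite [0 ^+ _]expr0n subn_eq0 leqNgt ltn_neqAle ne_in le_en //=.
    by rewrite !mulr0.
  rewrite addr0; apply: eq_bigr => i /andP[_ /eqP->].
  by rewrite subnn expr1n !mulr1.
pose p : {poly K} := \sum_(i <- r | P i && (e i != n)) c i *: 'X^(e i).
have p_eq0 : p = 0.
  apply: (@roots_geq_poly_eq0 _ _ (enum K)); first last.
  - rewrite -cardE; apply/leq_sizeP => j le_Kj; rewrite coef_sum big1 // => i.
    case/andP=> Pi ne_in; have:= e_red i Pi; rewrite (negPf ne_in) /= => lt_eK.
    by rewrite coefZ coefXn gtn_eqF ?mulr0 // (leq_trans lt_eK).
  - exact: enum_uniq.
  apply/allP=> x _; rewrite /root /p horner_sum.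
  rewrite -[X in _ == X](vanish x 1) ?oner_eq0 ?orbT //.
  rewrite [X in _ == X](bigID (fun i => e i == n)) /=.
  rewrite [X in _ == X + _](_ : _ = 0).
    rewrite add0r; apply/eqP; apply: eq_bigr => i _.
    by rewrite expr1n mulr1 !hornerE.
  rewrite -[RHS](mul0r (x ^+ n)) -[X in _ = X * _]top0 mulr_suml.
  apply: eq_bigr => i /andP[_ /eqP->].
  by rewrite expr1n mulr1.
move=> k; case: (eqVneq k n) => [->|ne_kn] //.
rewrite -[RHS](coef0 K k) -p_eq0 /p coef_sum [RHS](bigID (fun i => e i == k)) /=.
rewrite [X in _ = _ + X]big1 => [|i /andP[_ ne_ik]]; last first.
  by rewrite coefZ coefXn eq_sym (negPf ne_ik) mulr0.
rewrite addr0; apply: eq_big => [i|i /andP[_ /eqP->]].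
  by case: eqP => [->|_]; rewrite ?andbF // ne_kn !andbT.
by rewrite coefZ coefXn eqxx mulr1.
Qed.

Lemma vanishing_form_reduction (K : finFieldType) (I : Type) (r : seq I)
    (P : pred I) (c : I -> K) (e : I -> nat) n :
    (forall i, P i -> (e i <= n)%N) ->
    (forall s t : K, (s != 0) || (t != 0) ->
       \sum_(i <- r | P i) c i * (s ^+ e i * t ^+ (n - e i)) = 0) ->
  forall k, \sum_(i <- r | P i && (reduced_exp #|K| n (e i) == k)) c i = 0.
Proof.
move=> le_en vanish; have K_gt1 := finNzRing_gt1 K.
apply: (@reduced_form_eq0 K I r P c _ n) => [i Pi|i Pi|s t st].
- exact: leq_trans (reduced_exp_le _ (le_en i Pi)) (le_en i Pi).
- exact: reduced_exp_small.
- rewrite -[RHS](vanish s t st); apply: eq_bigr => i Pi; congr (_ * _).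
  rewrite [RHS](monomial_reduction _ _ K_gt1 (le_en i Pi)).
  by rewrite /frob_form !expf_card subrr mul0r addr0.
Qed.

Lemma fibrewise_sum_eq0 (K : nzRingType) (V : lmodType K) (I : Type) (J : finType)
    (r : seq I) (P : pred I) (h : I -> J) (c : I -> K) (phi : J -> V) :
    (forall k, \sum_(i <- r | P i && (h i == k)) c i = 0) ->
  \sum_(i <- r | P i) c i *: phi (h i) = 0.
Proof.
move=> fib0; rewrite (partition_big h xpredT) //= big1 // => k _.
rewrite -[RHS](scale0r (phi k)) -(fib0 k) scaler_suml.
by apply: eq_bigr => i /andP[_ /eqP->].
Qed.

(** * Multiples of the Frobenius form are reducible *)

(** Split off the factor s: both s and its cofactor vanish at the origin, hence
    neither is a unit. *)
Lemma frob_form_multiple_reducible (K : fieldType) N q (s t g : {mpoly K[N]}) :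
    (1 < q)%N -> s.@[fun=> 0] = 0 -> t.@[fun=> 0] = 0 ->
  ~ irreducible_elt (g * frob_form q s t).
Proof.
move=> q_gt1 s0 t0 [_ _ irr].
have nonunit (p : {mpoly K[N]}) : p.@[fun=> 0] = 0 -> p \is a GRing.unit -> False.
  by move=> p0 /(rmorph_unit (meval (fun=> 0))); rewrite /= p0 unitr0.
have eqM : g * frob_form q s t = s * (g * (s ^+ q.-1 * t - t ^+ q)).
  by rewrite /frob_form -[in s ^+ q](ltn_predK q_gt1) exprS; ring.
case: (irr _ _ eqM); apply: nonunit => //.
rewrite rmorphM rmorphB rmorphM !rmorphXn /= t0 mulr0 expr0n.
by rewrite -(ltn_predK q_gt1) subrr mulr0.
Qed.

(** * Bi-homogeneous polynomials *)

Lemma mpolyX_bihomog (K : fieldType) (m : 'X_{1..2 + 2}) a b :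
    degX m = a -> degY m = b ->
  'X_[K, m] = X0 ^+ m (lshift 2 ord0) * X1 ^+ (a - m (lshift 2 ord0)) *
     (Y0 ^+ m (rshift 2 ord0) * Y1 ^+ (b - m (rshift 2 ord0))).
Proof.
move=> <- <-; rewrite mpolyXE_id big_split_ord /= /degX /degY.
rewrite !big_ord_recl !big_ord0 !mulr1 !addn0 !addKn.
rewrite /X0 /X1 /Y0 /Y1.
by have -> : lift ord0 ord0 = ord_max :> 'I_2 by apply: val_inj.
Qed.

Lemma bihomog_expansion (K : fieldType) a b (F : {mpoly K[2 + 2]}) :
  bihomog a b F -> F =
   \sum_(m <- msupp F | m \in msupp F) F@_m *:
    (X0 ^+ m (lshift 2 ord0) * X1 ^+ (a - m (lshift 2 ord0)) *
     (Y0 ^+ m (rshift 2 ord0) * Y1 ^+ (b - m (rshift 2 ord0)))).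
Proof.
case/andP=> /dhomogP hX /dhomogP hY.
rewrite {1}[F]mpolyE big_seq; apply: eq_bigr => m Fm.
by rewrite (mpolyX_bihomog K (hX m Fm) (hY m Fm)).
Qed.

Lemma curve_points_meval (K : finFieldType) (F : {mpoly K[2 + 2]}) :
    curve_points F =i {: proj_line K * proj_line K} ->
  forall x y : 'rV[K]_2, x != 0 -> y != 0 -> F.@[row_mx x y ord0] = 0.
Proof.
move=> F_pts x y x0 y0.
have line (z : 'rV[K]_2) : z != 0 -> \dim <[z]> == 1 by move=> z0; rewrite dim_vline z0.
have := F_pts (exist _ <[x]>%VS (line x x0), exist _ <[y]>%VS (line y y0)).
rewrite inE => /forallP/(_ x)/forallP/(_ y) /=.
by rewrite !memv_line x0 y0 => /eqP.
Qed.

Lemma bihomogM (K : fieldType) a b c d (p r : {mpoly K[2 + 2]}) :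
  bihomog a b p -> bihomog c d r -> bihomog (a + c) (b + d) (p * r).
Proof.
by case/andP=> pX pY /andP[rX rY]; rewrite /bihomog; apply/andP; split; apply: dhomogM.
Qed.

Lemma bihomog_sum (K : fieldType) a b (I : Type) (r : seq I) (P : pred I)
    (c : I -> K) (p : I -> {mpoly K[2 + 2]}) :
  (forall i, P i -> bihomog a b (p i)) ->
  bihomog a b (\sum_(i <- r | P i) c i *: p i).
Proof.
move=> hp; apply/andP; split; apply: rpred_sum => i /hp/andP[pX pY];
  exact: dhomogZ.
Qed.

Lemma bihomogXn (K : fieldType) a b n (p : {mpoly K[2 + 2]}) :
  bihomog a b p -> bihomog (a * n) (b * n) (p ^+ n).
Proof. by case/andP=> pX pY; apply/andP; split; apply: dhomogMn. Qed.

Lemma bihomog_form (K : fieldType) c d i n (s t : {mpoly K[2 + 2]}) :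
    bihomog c d s -> bihomog c d t -> (i <= n)%N ->
  bihomog (c * n) (d * n) (s ^+ i * t ^+ (n - i)).
Proof.
move=> hs ht le_in; rewrite -(subnKC le_in) !mulnDr addKn.
by apply: bihomogM; apply: bihomogXn.
Qed.

Lemma bihomog_reduction_quotient (K : fieldType) c d q n i
    (s t : {mpoly K[2 + 2]}) :
    (1 < q)%N -> bihomog c d s -> bihomog c d t -> (i <= n)%N ->
  bihomog (c * (n - (q + 1))) (d * (n - (q + 1))) (reduction_quotient q n i s t).
Proof.
move=> q_gt1 /andP[sX sY] /andP[tX tY] le_in.
by apply/andP; split; apply: reduction_quotient_homog.
Qed.

Lemma bihomog_coordX (K : fieldType) (i : 'I_2) :
  bihomog 1 0 ('X_(lshift 2 i) : {mpoly K[2 + 2]}).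
Proof.
rewrite /bihomog !dhomogX /= /degX /degY (bigD1 i) //= !big1 => [|j _|j ne_ji].
- by rewrite mnm1E !eqxx.
- by rewrite mnm1E eq_lrshift.
- by rewrite mnm1E eq_lshift eq_sym (negPf ne_ji).
Qed.

Lemma bihomog_coordY (K : fieldType) (i : 'I_2) :
  bihomog 0 1 ('X_(rshift 2 i) : {mpoly K[2 + 2]}).
Proof.
rewrite /bihomog !dhomogX /= /degX /degY [X in _ && (X == _)](bigD1 i) //=.
rewrite !big1 => [|j ne_ji|j _].
- by rewrite mnm1E !eqxx.
- by rewrite mnm1E eq_rshift eq_sym (negPf ne_ji).
- by rewrite mnm1E eq_rlshift.
Qed.

(** * The decomposition and the degree bounds *)

Theorem lemma2p1 (q : nat) (K : finFieldType) (cardK : #|K| = q)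
    (a b : nat) (F : {mpoly K[2 + 2]})
    (F_irr : irreducible_elt F) (F_bihom : bihomog a b F)
    (F_pts : curve_points F =i {: proj_line K * proj_line K}) :
  [/\ (q + 1 <= a)%N, (q + 1 <= b)%N &
      exists f g : {mpoly K[2 + 2]},
        [/\ bihomog (a - (q + 1)) b f, bihomog a (b - (q + 1)) g &
            F = f * (X0 ^+ q * X1 - X0 * X1 ^+ q)
              + g * (Y0 ^+ q * Y1 - Y0 * Y1 ^+ q)]].
Proof.
have q_gt1 : (1 < q)%N by rewrite -cardK finNzRing_gt1.
pose eX (m : 'X_{1..2 + 2}) := m (lshift 2 ord0).
pose eY (m : 'X_{1..2 + 2}) := m (rshift 2 ord0).
pose rX m := reduced_exp q a (eX m); pose rY m := reduced_exp q b (eY m).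
have eX_le m : m \in msupp F -> (eX m <= a)%N.
  move=> Fm; case/andP: F_bihom => /dhomogP/(_ m Fm)<- _.
  by rewrite /= /degX big_ord_recl leq_addr.
have eY_le m : m \in msupp F -> (eY m <= b)%N.
  move=> Fm; case/andP: F_bihom => _ /dhomogP/(_ m Fm)<-.
  by rewrite /= /degY big_ord_recl leq_addr.
have rX_le m : m \in msupp F -> (rX m <= a)%N.
  by move=> Fm; apply: leq_trans (reduced_exp_le _ (eX_le m Fm)) (eX_le m Fm).
have rY_le m : m \in msupp F -> (rY m <= b)%N.
  by move=> Fm; apply: leq_trans (reduced_exp_le _ (eY_le m Fm)) (eY_le m Fm).
have F_eq := bihomog_expansion F_bihom.
have F_vanish (s t u v : K) : (s != 0) || (t != 0) -> (u != 0) || (v != 0) ->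
    \sum_(m <- msupp F | m \in msupp F)
      F@_m * (s ^+ eX m * t ^+ (a - eX m)) * (u ^+ eY m * v ^+ (b - eY m)) = 0.
  move=> st uv; pose pt (x y : K) : 'rV[K]_2 := \row_i (if i == ord0 then x else y).
  have pt_neq0 x y : (x != 0) || (y != 0) -> pt x y != 0.
    apply: contraTneq => /rowP pt0; have := pt0 ord0; have := pt0 ord_max.
    by rewrite !mxE /= => -> ->; rewrite eqxx.
  have := curve_points_meval F_pts (pt_neq0 _ _ st) (pt_neq0 _ _ uv).
  rewrite [in F.@[_]]F_eq raddf_sum /= => F0; rewrite -[RHS]F0; apply: eq_bigr => m _.
  rewrite mevalZ !rmorphM !rmorphXn /= /X0 /X1 /Y0 /Y1 !mevalXU.
  by rewrite !row_mxEl !row_mxEr !mxE /= -[LHS]mulrA.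
(* The coefficients of the part of F that is reduced in both pairs of
   variables: [vanishing_form_reduction] is applied in Y at fixed exponent of X,
   and its hypothesis is proved by applying it in X at a fixed point (u, v). *)
have fibre0 k l : \sum_(m <- msupp F | (m \in msupp F) && (rX m == k) && (rY m == l))
    F@_m = 0.
  rewrite /rY -cardK; apply: (vanishing_form_reduction (n := b)) => [m /andP[Fm _]|u v uv].
    exact: eY_le.
  rewrite /rX -cardK.
  apply: (vanishing_form_reduction (c := fun m => F@_m * (u ^+ eY m * v ^+ (b - eY m)))
            (n := a)) => // s t st.
  rewrite -[RHS](F_vanish s t u v) //; apply: eq_bigr => m _.
  by rewrite mulrAC.
pose f := \sum_(m <- msupp F | m \in msupp F) F@_m *:
  (reduction_quotient q a (eX m) X0 X1 * (Y0 ^+ eY m * Y1 ^+ (b - eY m))).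
pose g := \sum_(m <- msupp F | m \in msupp F) F@_m *:
  (X0 ^+ rX m * X1 ^+ (a - rX m) * reduction_quotient q b (eY m) Y0 Y1).
have F_dec : F = f * frob_form q X0 X1 + g * frob_form q Y0 Y1.
  have red0 : \sum_(m <- msupp F | m \in msupp F) F@_m *:
     (X0 ^+ rX m * X1 ^+ (a - rX m) * (Y0 ^+ rY m * Y1 ^+ (b - rY m))) = 0 :> {mpoly K[2 + 2]}.
    pose h m : 'I_a.+1 * 'I_b.+1 := (inord (rX m), inord (rY m)).
    pose phi (k : 'I_a.+1 * 'I_b.+1) : {mpoly K[2 + 2]} :=
      X0 ^+ k.1 * X1 ^+ (a - k.1) * (Y0 ^+ k.2 * Y1 ^+ (b - k.2)).
    rewrite -[RHS](@fibrewise_sum_eq0 _ _ _ _ (msupp F) (fun m => m \in msupp F)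
                     h (fun m => F@_m) phi) => [|[k l]].
      by apply: eq_bigr => m Fm; rewrite /phi !inordK ?ltnS ?rX_le ?rY_le.
    rewrite -[RHS](fibre0 k l); apply: eq_bigl => m; case Fm: (m \in _) => //=.
    by rewrite xpair_eqE -!val_eqE /= !inordK ?ltnS ?rX_le ?rY_le.
  rewrite -[RHS]add0r -red0 !mulr_suml -!big_split {1}F_eq /=.
  apply: eq_bigr => m Fm; rewrite -!scalerAl -!scalerDr; congr (_ *: _).
  exact: (bimonomial_reduction _ _ _ _ q_gt1 (eX_le m Fm) (eY_le m Fm)).
have zero_coord i : ('X_i : {mpoly K[2 + 2]}).@[fun=> 0] = 0 by rewrite mevalXU.
split.
- rewrite leqNgt; apply/negP => a_small.
  apply: (@frob_form_multiple_reducible K _ q Y0 Y1 g q_gt1); rewrite ?zero_coord //.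
  suff f0 : f = 0 by move: F_dec; rewrite f0 mul0r add0r => <-.
  rewrite /f big1 // => m Fm.
  by rewrite reduction_quotient_eq0 ?mul0r ?scaler0 ?eX_le.
- rewrite leqNgt; apply/negP => b_small.
  apply: (@frob_form_multiple_reducible K _ q X0 X1 f q_gt1); rewrite ?zero_coord //.
  suff g0 : g = 0 by move: F_dec; rewrite g0 mul0r addr0 => <-.
  rewrite /g big1 // => m Fm.
  by rewrite reduction_quotient_eq0 ?mulr0 ?scaler0 ?eY_le.
exists f, g; split; last exact: F_dec.
- apply: bihomog_sum => m Fm.
  have := bihomogM
    (bihomog_reduction_quotient q_gt1 (bihomog_coordX K ord0)
       (bihomog_coordX K ord_max) (eX_le m Fm))
    (bihomog_form (bihomog_coordY K ord0) (bihomog_coordY K ord_max) (eY_le m Fm)).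
  by rewrite !mul1n !mul0n addn0 add0n.
- apply: bihomog_sum => m Fm.
  have := bihomogM
    (bihomog_form (bihomog_coordX K ord0) (bihomog_coordX K ord_max) (rX_le m Fm))
    (bihomog_reduction_quotient q_gt1 (bihomog_coordY K ord0)
       (bihomog_coordY K ord_max) (eY_le m Fm)).
  by rewrite !mul1n !mul0n addn0 add0n.
Qed.
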